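(* If a regular cardinal $\kappa>2^{\aleph_1}$ carries a uniform indecomposable ultrafilter, then every $\kappa$-Aronszajn tree admits an $\omega$-ascent path.
   Context: An ultrafilter $U$ over $\kappa$ is uniform if all its members have size $\kappa$; it is $\mu$-indecomposable if for every $f:\kappa\to\mu$ there is $H\subseteq\mu$ with $|H|<\mu$ and $f^{-1}[H]\in U$; it is indecomposable if it is $\mu$-indecomposable for all cardinals $\mu\in[\aleph_1,\kappa)$. For a tree $(T,<_T)$ of height $\kappa$ with levels $T_\alpha$, an $\omega$-ascent path is a sequence $\langle f_\alpha\mid\alpha<\kappa\rangle$ with $f_\alpha:\omega\to T_\alpha$ such that for all $\alpha<\beta<\kappa$, the set $\{i<\omega\mid f_\alpha(i)<_T f_\beta(i)\}$ contains a tail of $\omega$ (i.e., is cofinite). *)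

(* Defs.v *)
(* Set-theoretic combinatorics on a well-ordered type K
   representing the cardinal kappa (an initial ordinal). Sets are predicates. *)
From Stdlib Require Import Arith.

Set Implicit Arguments.

Section Defs.

Definition card_le {X Y : Type} (A : X -> Prop) (B : Y -> Prop) : Prop :=
  exists f : X -> Y,
    (forall x, A x -> B (f x)) /\
    (forall x x', A x -> A x' -> f x = f x' -> x = x').

Definition card_lt {X Y : Type} (A : X -> Prop) (B : Y -> Prop) : Prop :=
  card_le A B /\ ~ card_le B A.

Definition fullset (X : Type) : X -> Prop := fun _ => True.
Arguments fullset X _ : clear implicits.

Definition countable {X : Type} (A : X -> Prop) : Prop :=
  card_le A (fullset nat).

Variable K : Type.
Variable lt : K -> K -> Prop.

Definition strict_wellorder : Prop :=
  well_founded lt /\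
  (forall x y z, lt x y -> lt y z -> lt x z) /\
  (forall x y, lt x y \/ x = y \/ lt y x).

Definition below (a : K) : K -> Prop := fun b => lt b a.

Definition is_cardinal_order : Prop :=
  forall a, card_lt (below a) (fullset K).

Definition regular_order : Prop :=
  forall S : K -> Prop, card_lt S (fullset K) ->
    exists a, forall b, S b -> lt b a.

Definition is_omega1 (w1 : K) : Prop :=
  ~ countable (below w1) /\ (forall b, lt b w1 -> countable (below b)).

Definition gt_two_pow_aleph1 : Prop :=
  exists w1, is_omega1 w1 /\
    card_lt (fullset ({b : K | lt b w1} -> Prop)) (fullset K).

Definition uncountable_cardinal_below (mu : K) : Prop :=
  ~ countable (below mu) /\
  (forall nu, lt nu mu -> ~ card_le (below mu) (below nu)).

Definition ultrafilter (U : (K -> Prop) -> Prop) : Prop :=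
  U (fullset K) /\
  ~ U (fun _ => False) /\
  (forall A B : K -> Prop, U A -> (forall x, A x -> B x) -> U B) /\
  (forall A B : K -> Prop, U A -> U B -> U (fun x => A x /\ B x)) /\
  (forall A : K -> Prop, U A \/ U (fun x => ~ A x)).

Definition uniform (U : (K -> Prop) -> Prop) : Prop :=
  forall A, U A -> card_le (fullset K) A.

(* mu-indecomposable, with mu represented by its set of predecessors *)
Definition mu_indecomposable (U : (K -> Prop) -> Prop) (mu : K) : Prop :=
  forall f : K -> K, (forall x, lt (f x) mu) ->
    exists H : K -> Prop,
      (forall b, H b -> lt b mu) /\ card_lt H (below mu) /\
      U (fun x => H (f x)).

Definition indecomposable (U : (K -> Prop) -> Prop) : Prop :=
  forall mu, uncountable_cardinal_below mu -> mu_indecomposable U mu.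

Variable T : Type.
Variable ltT : T -> T -> Prop.

(* t lies on level a : the predecessors of t, ordered by ltT, are
   order-isomorphic to the ordinal a (= its set of predecessors in K) *)
Definition on_level (t : T) (a : K) : Prop :=
  exists g : T -> K,
    (forall s, ltT s t -> lt (g s) a) /\
    (forall b, lt b a -> exists s, ltT s t /\ g s = b) /\
    (forall s s', ltT s t -> ltT s' t -> (ltT s s' <-> lt (g s) (g s'))).

Definition level (a : K) : T -> Prop := fun t => on_level t a.

Definition tree_of_height_kappa : Prop :=
  (forall t, ~ ltT t t) /\
  (forall r s t, ltT r s -> ltT s t -> ltT r t) /\
  (forall t, exists a, on_level t a) /\
  (forall a, exists t, on_level t a).

Definition cofinal_branch (B : T -> Prop) : Prop :=
  (forall s t, B s -> B t -> ltT s t \/ s = t \/ ltT t s) /\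
  (forall a, exists t, B t /\ on_level t a).

Definition kappa_aronszajn : Prop :=
  tree_of_height_kappa /\
  (forall a, card_lt (level a) (fullset K)) /\
  (forall B, ~ cofinal_branch B).

Definition omega_ascent_path (f : K -> nat -> T) : Prop :=
  (forall a i, on_level (f a i) a) /\
  (forall a b, lt a b -> exists n, forall i, n <= i -> ltT (f a i) (f b i)).

End Defs.

(* Main.v *)
(** By Silver's argument, [kappa > 2^aleph_1] and indecomposability give [f : kappa -> omega]
    such that modulo [U] every function on [kappa] with fewer than [kappa] values factors
    through [f]. Fix [t_b] on level [b]; then [b |-> t_b restricted to a] equals [h_a o f] on a
    set in [U], and [b |-> {n | h_a n < h_b n}] equals [R_a o f] on a set in [U]. As
    [2^omega < kappa], [R_a] is a fixed [R] for unboundedly many [a]. For two such [a < a'],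
    some [m] has [R m] in the image ultrafilter [f_* U] and both [h_a n], [h_a' n] below the
    same [h_b n] for all [n] in [R m], so that [h_a n < h_a' n] there. Choosing [n_k] in all
    those [R m] with [m <= k] that belong to [f_* U], the sequences [k |-> h_a n_k] are
    increasing modulo finite sets. *)
Require Import Defs.
From Stdlib Require Import Arith Lia Cantor Classical ClassicalEpsilon
  FunctionalExtensionality PropExtensionality
  Wellfounded.Lexicographic_Product Relation_Operators.

Set Implicit Arguments.

(** * Recursion and choice along well-founded relations *)

Lemma pred_ext (X : Type) (P Q : X -> Prop) : (forall x, P x <-> Q x) -> P = Q.
Proof.
  intros H; apply functional_extensionality; intros x.
  apply propositional_extensionality, H.
Qed.

Lemma wf_irrefl (X : Type) (R : X -> X -> Prop) (Rwf : well_founded R) x : ~ R x x.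
Proof. induction (Rwf x) as [x _ IH]; intros H; exact (IH x H H). Qed.

Lemma wf_minimal (X : Type) (R : X -> X -> Prop) (Rwf : well_founded R) (P : X -> Prop) :
  (exists x, P x) -> exists x, P x /\ forall y, R y x -> ~ P y.
Proof.
  intros [x Px]; induction (Rwf x) as [x _ IH].
  destruct (classic (exists y, R y x /\ P y)) as [[y [Ryx Py]]|N].
  - exact (IH y Ryx Py).
  - exists x; split; [exact Px|]; intros y Ryx Py; apply N; eauto.
Qed.

(** Choice where the admissible values at [x] depend on all earlier choices: [Fix] is applied to a
    choice function for [P]. *)
Lemma wf_choice (X Y : Type) (R : X -> X -> Prop) (Rwf : well_founded R)
  (P : forall x, ({y | R y x} -> Y) -> Y -> Prop) :
  (forall x g, exists y, P x g y) ->
  exists f : X -> Y, forall x, P x (fun y => f (proj1_sig y)) (f x).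
Proof.
  intros H.
  set (s := fun x g => constructive_indefinite_description _ (H x g)).
  set (F := fun x (rec : forall y, R y x -> Y) =>
    proj1_sig (s x (fun y => rec (proj1_sig y) (proj2_sig y)))).
  exists (Fix Rwf (fun _ => Y) F); intros x.
  rewrite (Fix_eq Rwf (fun _ => Y) F).
  - unfold F at 2. exact (proj2_sig (s x _)).
  - intros z f g E; f_equal.
    apply functional_extensionality_dep; intros y.
    apply functional_extensionality_dep; intros Hy; apply E.
Qed.

(** Greedy enumeration of [A] without repetition along [R], for as long as earlier values have not
    exhausted [A]. *)
Lemma wf_greedy (Z X : Type) (R : Z -> Z -> Prop) (Rwf : well_founded R)
  (x0 : X) (A : X -> Prop) :
  exists psi : Z -> X, forall z,
    (exists x, A x /\ forall z', R z' z -> psi z' <> x) ->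
    A (psi z) /\ forall z', R z' z -> psi z' <> psi z.
Proof.
  destruct (@wf_choice Z X R Rwf (fun z g y =>
    (exists x, A x /\ forall z', g z' <> x) -> A y /\ forall z', g z' <> y)) as [f Hf].
  - intros z g.
    destruct (classic (exists x, A x /\ forall z', g z' <> x)) as [[x Hx]|N].
    + exists x; auto.
    + exists x0; intros E; contradiction.
  - exists f; intros z [x [Ax Hx]].
    destruct (Hf z) as [H1 H2].
    + exists x; split; [exact Ax|]; intros [z' Hz']; exact (Hx z' Hz').
    + split; [exact H1|]; intros z' Hz'; exact (H2 (exist _ z' Hz')).
Qed.

(** * Comparing cardinalities of predicates *)

Lemma card_le_trans (X Y Z : Type) (A : X -> Prop) (B : Y -> Prop) (C : Z -> Prop) :
  card_le A B -> card_le B C -> card_le A C.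
Proof.
  intros [f [f1 f2]] [g [g1 g2]]; exists (fun x => g (f x)); split; auto.
Qed.

Lemma card_le_lt_trans (X Y Z : Type) (A : X -> Prop) (B : Y -> Prop) (C : Z -> Prop) :
  card_le A B -> card_lt B C -> card_lt A C.
Proof.
  intros AB [BC CB]; split; [exact (card_le_trans AB BC)|].
  intros CA; exact (CB (card_le_trans CA AB)).
Qed.

Lemma card_le_subset (X : Type) (A B : X -> Prop) :
  (forall x, A x -> B x) -> card_le A B.
Proof. intros H; exists (fun x => x); auto. Qed.

Lemma card_le_cover (X Y : Type) (A : X -> Prop) (B : Y -> Prop) (p : Y -> X) (y0 : Y) :
  (forall x, A x -> exists y, B y /\ p y = x) -> card_le A B.
Proof.
  intros H.
  destruct (choice (fun x y => A x -> B y /\ p y = x)) as [f Hf].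
  - intros x; destruct (classic (A x)) as [Ax|N].
    + destruct (H x Ax) as [y Hy]; exists y; auto.
    + exists y0; intros; contradiction.
  - exists f; split; [intros x Ax; apply (Hf x Ax)|].
    intros x x' Ax Ax' E.
    rewrite <- (proj2 (Hf x Ax)), <- (proj2 (Hf x' Ax')), E; reflexivity.
Qed.

Lemma countable_union (X : Type) (A : nat -> X -> Prop) :
  (forall n, countable (A n)) -> countable (fun x => exists n, A n x).
Proof.
  intros H.
  destruct (choice _ H) as [f Hf].
  destruct (choice (fun x n => (exists m, A m x) -> A n x)) as [N HN].
  { intros x; destruct (classic (exists m, A m x)) as [[m Hm]|E].
    - exists m; auto.
    - exists 0; intros; contradiction. }
  exists (fun x => to_nat (N x, f (N x) x)); split; [exact (fun _ _ => I)|].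
  intros x x' Ax Ax' E.
  apply (f_equal of_nat) in E; rewrite !cancel_of_to in E.
  pose proof (HN x Ax) as Bx; pose proof (HN x' Ax') as Bx'.
  injection E as E1 E2; rewrite <- E1 in *.
  exact (proj2 (Hf (N x)) x x' Bx Bx' E2).
Qed.

Lemma countable_image (X : Type) (p : nat -> X) : countable (fun x => exists n, p n = x).
Proof.
  apply card_le_cover with p; [exact 0|].
  intros x [n Hn]; exists n; split; [exact I|exact Hn].
Qed.

Lemma card_le_powerset (Z W : Type) :
  card_le (@fullset Z) (@fullset W) -> card_le (@fullset (Z -> Prop)) (@fullset (W -> Prop)).
Proof.
  intros [i [_ Hi]].
  exists (fun P w => exists z, i z = w /\ P z); split; [exact (fun _ _ => I)|].
  assert (Q : forall P P' : Z -> Prop,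
    (fun w => exists z, i z = w /\ P z) = (fun w => exists z, i z = w /\ P' z) ->
    forall z, P z -> P' z).
  { intros P P' E z Pz.
    assert (H : exists z', i z' = i z /\ P' z').
    { change ((fun w => exists z, i z = w /\ P' z) (i z)); rewrite <- E; eauto. }
    destruct H as [z' [e Pz']]; rewrite <- (Hi z' z I I e); exact Pz'. }
  intros P P' _ _ E; apply pred_ext; split; apply Q; auto.
Qed.

Lemma card_le_graphs (X Y : Type) :
  card_le (@fullset (X -> Y)) (@fullset (X * Y -> Prop)).
Proof.
  exists (fun F p => F (fst p) = snd p); split; [exact (fun _ _ => I)|].
  intros F G _ _ E; apply functional_extensionality; intros x.
  change ((fun p => F (fst p) = snd p) (x, G x)); rewrite E; reflexivity.
Qed.

(** * Well-orders and the arithmetic of the first uncountable ordinal *)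

Section WellOrder.

Variables (K : Type) (lt : K -> K -> Prop).
Hypothesis Hwo : strict_wellorder lt.

Let wf : well_founded lt := proj1 Hwo.
Let trans : forall x y z, lt x y -> lt y z -> lt x z := proj1 (proj2 Hwo).
Let trich : forall x y, lt x y \/ x = y \/ lt y x := proj2 (proj2 Hwo).

Lemma below_inj a b : (forall c, lt c a <-> lt c b) -> a = b.
Proof.
  intros H; destruct (trich a b) as [L|[E|L]]; [|exact E|]; exfalso;
    apply H in L; exact (wf_irrefl wf _ L).
Qed.

(** Enumerate [A] greedily along [K]: either the enumeration stays injective on all of
    [below lt mu], or it has exhausted [A] below some [nu < mu]. *)
Lemma card_below_dichotomy (A : K -> Prop) mu :
  card_le (below lt mu) A \/ exists nu, lt nu mu /\ card_le A (below lt nu).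
Proof.
  destruct (@wf_greedy K K lt wf mu A) as [psi Hpsi].
  destruct (classic (forall nu, lt nu mu ->
    exists x, A x /\ forall z', lt z' nu -> psi z' <> x)) as [H|H].
  - left; exists psi; split.
    + intros x Hx; apply (Hpsi x), H, Hx.
    + intros x x' Hx Hx' E.
      destruct (trich x x') as [L|[L|L]]; [|exact L|]; exfalso.
      * exact (proj2 (Hpsi x' (H x' Hx')) x L E).
      * exact (proj2 (Hpsi x (H x Hx)) x' L (eq_sym E)).
  - right; apply not_all_ex_not in H; destruct H as [nu H].
    apply imply_to_and in H; destruct H as [L H].
    exists nu; split; [exact L|]; apply card_le_cover with psi; [exact mu|].
    intros x Ax; apply NNPP; intros N; apply H; exists x; split; [exact Ax|].
    intros z' Lz E; apply N; exists z'; split; [exact Lz|exact E].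
Qed.

Section Omega1.

Variable w1 : K.
Hypothesis Hw1 : is_omega1 lt w1.

Lemma omega1_nonempty : exists b, lt b w1.
Proof.
  apply NNPP; intros N; apply (proj1 Hw1).
  exists (fun _ => 0); split; [exact (fun _ _ => I)|].
  intros x x' Hx; exfalso; apply N; exists x; exact Hx.
Qed.

(** Without such a [d], countably many countable initial segments would cover [below lt w1]. *)
Lemma omega1_cofinality (D : nat -> K) :
  (forall n, lt (D n) w1) -> exists d, lt d w1 /\ forall n, lt (D n) d.
Proof.
  intros HD; apply NNPP; intros N; apply (proj1 Hw1).
  apply card_le_trans with (B := fun x => exists n, lt x (D n) \/ D n = x).
  - apply card_le_subset; intros x Hx; apply NNPP; intros M; apply N.
    exists x; split; [exact Hx|]; intros n.
    destruct (trich (D n) x) as [L|[L|L]]; [exact L| |]; exfalso; apply M; eauto.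
  (* A union of two sets is written as a countable union: [if k] takes its first branch at [k = 0]
     and its second branch at every other [k]. *)
  - apply card_le_trans with (B := fun x => exists k : nat,
      (if k then fun x => exists n, lt x (D n) else fun x => exists n, D n = x) x).
    + apply card_le_subset; intros x [n [H|H]]; [exists 0|exists 1]; eauto.
    + apply countable_union; intros [|k].
      * apply countable_union; intros n; exact (proj2 Hw1 (D n) (HD n)).
      * apply countable_image.
Qed.

(** This is aleph_1 x aleph_0 = aleph_1, by a greedy injection along the lexicographic order. *)
Lemma omega1_times_nat :
  exists psi : K -> nat -> K, (forall b n, lt b w1 -> lt (psi b n) w1) /\
    forall b n b' n', lt b w1 -> lt b' w1 -> psi b n = psi b' n' -> b = b' /\ n = n'.
Proof.
  set (R := slexprod K nat lt Peano.lt).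
  assert (Rwf : well_founded R) by (apply wf_slexprod; [exact wf|exact lt_wf]).
  destruct (@wf_greedy (K * nat) K R Rwf w1 (below lt w1)) as [psi Hpsi].
  (* The values at predecessors of [(b, n)] are among the [psi (c, m)] with [c <= b]; these are
     countably many, so they cannot exhaust [below lt w1]. *)
  assert (Hav : forall b n, lt b w1 ->
    exists x, below lt w1 x /\ forall z, R z (b, n) -> psi z <> x).
  { intros b n Hb; apply NNPP; intros N; apply (proj1 Hw1).
    apply card_le_trans with (B := fun x => exists m c, (lt c b \/ b = c) /\ psi (c, m) = x).
    - apply card_le_subset; intros x Hx; apply NNPP; intros M; apply N.
      exists x; split; [exact Hx|]; intros [c m] Hz E; apply M; exists m, c.
      split; [|exact E]; inversion Hz; subst; auto.
    - apply countable_union; intros m.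
      apply card_le_trans with (B := fun c => lt c b \/ b = c).
      + apply card_le_cover with (fun c => psi (c, m)); [exact b|].
        intros x [c Hc]; exists c; exact Hc.
      + apply card_le_trans with (B := fun c => exists k : nat,
          (if k then below lt b else fun c => exists n : nat, b = c) c).
        * apply card_le_subset; intros c [H|H]; [exists 0|exists 1]; [exact H|exists 0; exact H].
        * apply countable_union; intros [|k]; [exact (proj2 Hw1 b Hb)|].
          exact (countable_image (fun _ => b)). }
  exists (fun b n => psi (b, n)); split.
  - intros b n Hb; apply (Hpsi (b, n)), Hav, Hb.
  - intros b n b' n' Hb Hb' E.
    pose proof (proj2 (Hpsi _ (Hav b n Hb))) as H.
    pose proof (proj2 (Hpsi _ (Hav b' n' Hb'))) as H'.
    destruct (trich b b') as [L|[L|L]].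
    + exfalso; exact (H' (b, n) (left_slex _ _ _ _ _ _ _ _ L) E).
    + subst b'; split; [reflexivity|].
      destruct (lt_eq_lt_dec n n') as [[l|e]|l]; [|exact e|]; exfalso.
      * exact (H' (b, n) (right_slex _ _ _ _ _ _ _ l) E).
      * exact (H (b, n') (right_slex _ _ _ _ _ _ _ l) (eq_sym E)).
    + exfalso; exact (H (b', n') (left_slex _ _ _ _ _ _ _ _ L) (eq_sym E)).
Qed.

(** Passing to graphs, omega^b <= 2^(b x omega) <= 2^omega_1. The hypothesis admits [b = w1] as well
    as [b < w1]; both cases occur later. *)
Lemma card_le_nat_sequences (b : K) : (forall c, lt c b -> lt c w1) ->
  card_le (@fullset ({c | lt c b} -> nat)) (@fullset ({c | lt c w1} -> Prop)).
Proof.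
  intros Hb; apply (card_le_trans (card_le_graphs _ _)), card_le_powerset.
  destruct omega1_times_nat as [psi [psi_lt psi_inj]].
  exists (fun p => exist (fun c => lt c w1) (psi (proj1_sig (fst p)) (snd p))
    (psi_lt _ _ (Hb _ (proj2_sig (fst p))))); split; [exact (fun _ _ => I)|].
  intros [[c Hc] n] [[c' Hc'] n'] _ _ E; apply (f_equal (@proj1_sig _ _)) in E; simpl in E.
  destruct (psi_inj _ _ _ _ (Hb c Hc) (Hb c' Hc') E); subst.
  rewrite (proof_irrelevance _ Hc Hc'); reflexivity.
Qed.

Lemma card_le_nat_relations :
  card_le (@fullset (nat -> nat -> Prop)) (@fullset ({c | lt c w1} -> Prop)).
Proof.
  apply card_le_trans with (B := @fullset (nat * nat -> Prop)).
  { exists (fun Q p => Q (fst p) (snd p)); split; [exact (fun _ _ => I)|].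
    intros Q Q' _ _ E; apply functional_extensionality; intros i.
    apply functional_extensionality; intros j.
    exact (f_equal (fun S => S (i, j)) E). }
  apply card_le_powerset.
  destruct omega1_times_nat as [psi [psi_lt psi_inj]].
  destruct omega1_nonempty as [b Hb].
  exists (fun p => exist (fun c => lt c w1) (psi b (to_nat p)) (psi_lt _ _ Hb));
    split; [exact (fun _ _ => I)|].
  intros p p' _ _ E; apply (f_equal (@proj1_sig _ _)) in E; simpl in E.
  destruct (psi_inj _ _ _ _ Hb Hb E) as [_ e].
  rewrite <- (cancel_of_to p), <- (cancel_of_to p'), e; reflexivity.
Qed.

End Omega1.

End WellOrder.

(** [g] factors through [f] modulo [U]. *)
Definition determined (K X Y : Type) (U : (K -> Prop) -> Prop) (g : K -> X) (f : K -> Y) : Prop :=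
  exists A, U A /\ forall x y, A x -> A y -> f x = f y -> g x = g y.

(** * Functions modulo an indecomposable ultrafilter *)

Section IndecomposableUltrafilter.

Variables (K : Type) (lt : K -> K -> Prop).
Hypotheses (Hwo : strict_wellorder lt) (Hcard : is_cardinal_order lt)
  (Hreg : regular_order lt).
Variable U : (K -> Prop) -> Prop.
Hypotheses (HU : ultrafilter U) (Huni : uniform U) (Hind : indecomposable lt U).
Variable w1 : K.
Hypothesis Hw1 : is_omega1 lt w1.
Hypothesis Hbig : card_lt (@fullset ({b | lt b w1} -> Prop)) (@fullset K).

Let wf : well_founded lt := proj1 Hwo.
Let trans : forall x y z, lt x y -> lt y z -> lt x z := proj1 (proj2 Hwo).
Let trich : forall x y, lt x y \/ x = y \/ lt y x := proj2 (proj2 Hwo).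

Lemma ultrafilter_mono {A B : K -> Prop} : U A -> (forall x, A x -> B x) -> U B.
Proof. apply HU. Qed.

Lemma ultrafilter_and {A B : K -> Prop} : U A -> U B -> U (fun x => A x /\ B x).
Proof. apply HU. Qed.

Lemma ultrafilter_inhabited {A : K -> Prop} : U A -> exists x, A x.
Proof.
  intros H; apply NNPP; intros N; apply (proj1 (proj2 HU)).
  apply (ultrafilter_mono H); intros x Ax; apply N; eauto.
Qed.

Lemma determined_trans (X Y Z : Type) (h : K -> X) (g : K -> Y) (f : K -> Z) :
  determined U h g -> determined U g f -> determined U h f.
Proof.
  intros [A [UA HA]] [B [UB HB]].
  exists (fun x => A x /\ B x); split; [exact (ultrafilter_and UA UB)|].
  intros x y [Ax Bx] [Ay By] E; apply HA; auto.
Qed.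

(** [h] uses representatives in [A], and the default [g w1] outside the image of [A]. All its values
    are thus values of [g], which later keeps [h] inside a prescribed range. *)
Lemma determined_function (X Y : Type) (g : K -> X) (f : K -> Y) : determined U g f ->
  exists (A : K -> Prop) (h : Y -> X), U A /\ (forall x, A x -> g x = h (f x)) /\
    forall y, exists x, h y = g x.
Proof.
  intros [A [UA HA]].
  destruct (choice (fun y z => (exists x, A x /\ f x = y /\ g x = z) \/
    ~ (exists x, A x /\ f x = y) /\ g w1 = z)) as [h Hh].
  - intros y; destruct (classic (exists x, A x /\ f x = y)) as [[x [Ax E]]|N].
    + exists (g x); eauto.
    + exists (g w1); auto.
  - exists A, h; split; [exact UA|]; split.
    + intros x Ax; destruct (Hh (f x)) as [[x' [Ax' [E <-]]]|[N _]].
      * apply HA; auto.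
      * exfalso; eauto.
    + intros y; destruct (Hh y) as [[x [_ [_ E]]]|[_ E]]; eauto.
Qed.

Lemma exists_above a : exists b, lt a b.
Proof.
  destruct (Hreg (S := fun x => x = a)) as [b Hb]; [|exists b; apply Hb; reflexivity].
  split; [exists (fun x => x); split; [exact (fun _ _ => I)|auto]|].
  intros [f [f1 f2]]; destruct (omega1_nonempty Hw1) as [b Hb].
  assert (E : b = w1).
  { apply f2; [exact I|exact I|]; rewrite (f1 b I), (f1 w1 I); reflexivity. }
  rewrite E in Hb; exact (wf_irrefl wf _ Hb).
Qed.

(** Otherwise [U] contains the set of all [x <= a], which lies in some [below lt b] and so is too
    small for a uniform ultrafilter. *)
Lemma ultrafilter_tail a : U (lt a).
Proof.
  destruct (proj2 (proj2 (proj2 (proj2 HU))) (lt a)) as [H|H]; [exact H|exfalso].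
  destruct (exists_above a) as [b Hb].
  apply (proj2 (Hcard b)), Huni, (ultrafilter_mono H).
  intros x Hx; destruct (trich a x) as [L|[L|L]].
  - contradiction.
  - subst; exact Hb.
  - exact (trans L Hb).
Qed.

Lemma small_card_le_below (X : Type) (x0 : X) (S : X -> Prop) :
  card_lt S (@fullset K) -> exists a, card_le S (below lt a).
Proof.
  intros HS; destruct (proj1 HS) as [i [_ Hi]].
  destruct (Hreg (S := fun k => exists x, S x /\ i x = k)) as [a Ha].
  - refine (card_le_lt_trans _ HS); exact (card_le_cover _ _ i x0 (fun k H => H)).
  - exists a, i; split; [|exact Hi].
    intros x Sx; apply Ha; exists x; auto.
Qed.

(** If every fibre were bounded, regularity would give an [a] beyond all the bounds, yet [a] lies in
    the fibre of [Q a]. *)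
Lemma small_fibre_unbounded (Y : Type) (Q : K -> Y) :
  card_lt (@fullset Y) (@fullset K) -> exists q, forall a, exists b, lt a b /\ Q b = q.
Proof.
  intros HY; apply NNPP; intros N.
  destruct (choice (fun q a => forall b, lt a b -> Q b <> q)) as [s Hs].
  { intros q; apply NNPP; intros M; apply N; exists q; intros a.
    apply NNPP; intros P; apply M; exists a; intros b Hb E; apply P; eauto. }
  destruct (Hreg (S := fun k => exists q, s q = k)) as [a Ha].
  - refine (card_le_lt_trans _ HY); apply card_le_cover with s; [exact (Q w1)|].
    intros k [q Hq]; exists q; split; [exact I|exact Hq].
  - apply (Hs (Q a) a); [apply Ha; eauto|reflexivity].
Qed.

(** Take the least [mu] such that, on a set in [U], the values of [g] can be recoded injectively
    below [mu]. If [mu] were uncountable, indecomposability would yield a smaller one. *)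
Lemma small_range_countable (X : Type) (S : X -> Prop) (g : K -> X) :
  card_lt S (@fullset K) -> (forall x, S (g x)) ->
  exists G : K -> nat, determined U g G /\ determined U G g.
Proof.
  intros HS Hg.
  destruct (wf_minimal wf (fun mu => exists (A : K -> Prop) (c : K -> K), U A /\
    (forall x, A x -> lt (c x) mu) /\
    forall x y, A x -> A y -> (c x = c y <-> g x = g y)))
    as [mu [[A [c [UA [Hc Hcg]]]] Hmin]].
  { destruct (small_card_le_below (g w1) HS) as [a [i [i1 i2]]].
    exists a, (@fullset K), (fun x => i (g x)); split; [apply HU|]; split.
    - intros x _; apply i1, Hg.
    - intros x y _ _; split; [apply i2; apply Hg|congruence]. }
  destruct (classic (countable (below lt mu))) as [[p [_ Hp]]|Hunc].
  { exists (fun x => p (c x)); split; exists A; split; auto; intros x y Ax Ay E.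
    - apply Hcg; auto; apply Hp; auto; apply Hc; auto.
    - f_equal; apply Hcg; auto. }
  exfalso.
  assert (Hb : exists b, lt b mu).
  { apply NNPP; intros N; apply Hunc; exists (fun _ => 0); split; [exact (fun _ _ => I)|].
    intros x x' Hx; exfalso; apply N; exists x; exact Hx. }
  destruct Hb as [b Hb].
  (* Indecomposability speaks of total functions into [mu], so the code [c] is extended off [A] by
     the constant [b]. *)
  set (f := fun x => if excluded_middle_informative (A x) then c x else b).
  assert (Hf : forall x, lt (f x) mu).
  { intros x; unfold f; destruct (excluded_middle_informative (A x)); auto. }
  assert (Hfc : forall x, A x -> f x = c x).
  { intros x Ax; unfold f; destruct (excluded_middle_informative (A x)); tauto. }
  destruct (Hind (mu := mu)) with (f := f) as [H [_ [Hlt UH]]]; [|exact Hf|].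
  (* [mu] is a cardinal: an injection into a smaller [nu] would recode [g] below [nu]. *)
  - split; [exact Hunc|]; intros nu Hnu [p [p1 p2]]; apply (Hmin nu Hnu).
    exists A, (fun x => p (c x)); split; [exact UA|]; split.
    + intros x Ax; apply p1, Hc, Ax.
    + intros x y Ax Ay; rewrite <- Hcg by assumption; split; [|congruence].
      apply p2; apply Hc; assumption.
  (* As [H] is smaller than [mu], it injects into some [nu < mu], which recodes [g] below [nu] on
     the preimage of [H]. *)
  - destruct (card_below_dichotomy Hwo H mu) as [D|[nu [Hnu [p [p1 p2]]]]].
    + exact (proj2 Hlt D).
    + apply (Hmin nu Hnu).
      exists (fun x => A x /\ H (f x)), (fun x => p (f x)); split; [|split].
      * exact (ultrafilter_and UA UH).
      * intros x [_ Hx]; apply p1, Hx.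
      * intros x y [Ax Hx] [Ay Hy]; rewrite <- Hcg by assumption.
        rewrite <- (Hfc x Ax), <- (Hfc y Ay); split; [apply p2; assumption|congruence].
Qed.

(** Silver: otherwise pick, for [b < omega_1], some [F b : K -> nat] not determined by its
    predecessors; the joint function of all the [F b] has countable range modulo [U], and
    countably many branches through [omega^omega_1] are already separated at some [d < omega_1]. *)
Lemma finest_countable_partition :
  exists f : K -> nat, forall g : K -> nat, determined U g f.
Proof.
  apply NNPP; intros N.
  destruct (@wf_choice K (K -> nat) lt wf (fun b F y => lt b w1 ->
    ~ determined U y (fun x (c : {c | lt c b}) => F c x))) as [F HF].
  { intros b F.
    destruct (classic (lt b w1)) as [Hb|Hb]; [|exists (fun _ => 0); tauto].
    (* The joint function of the predecessors has at most 2^aleph_1 values, so it is determined by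
       some [G : K -> nat]. Any [g] not determined by [G] is then not determined by the joint
       function either. *)
    destruct (@small_range_countable ({c | lt c b} -> nat) (@fullset _)
      (fun x c => F c x)) as [G [JG GJ]]; [|exact (fun _ => I)|].
    { refine (card_le_lt_trans _ Hbig).
      apply (card_le_nat_sequences Hwo Hw1); intros c Hc; exact (trans Hc Hb). }
    apply not_ex_all_not with (n := G) in N; apply not_all_ex_not in N.
    destruct N as [g Hg]; exists g; intros _ D; exact (Hg (determined_trans D JG)). }
  destruct (@small_range_countable ({c | lt c w1} -> nat) (@fullset _)
    (fun x c => F (proj1_sig c) x)) as [G [[A [UA HA]] _]]; [|exact (fun _ => I)|].
  { refine (card_le_lt_trans _ Hbig).
    apply (card_le_nat_sequences Hwo Hw1); auto. }
  (* [p] codes a pair of values of [G]. On [A] these fix the two branches, so an index [d] where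
     they differ depends on [p] alone; if there is none, [b0] is a filler. *)
  assert (HD : forall p, exists d, lt d w1 /\ forall x y, A x -> A y ->
    of_nat p = (G x, G y) -> F d x = F d y -> forall c, lt c w1 -> F c x = F c y).
  { intros p; destruct (omega1_nonempty Hw1) as [b0 Hb0].
    destruct (classic (exists x y d, A x /\ A y /\ of_nat p = (G x, G y) /\
      lt d w1 /\ F d x <> F d y)) as [[x [y [d [Ax [Ay [E [Hd Hne]]]]]]]|M].
    - exists d; split; [exact Hd|]; intros x' y' Ax' Ay' E' Heq; exfalso; apply Hne.
      rewrite E in E'; injection E' as E1 E2.
      assert (Hev : forall u v, A u -> A v -> G u = G v -> F d u = F d v).
      { intros u v Au Av Euv.
        exact (f_equal (fun J => J (exist (fun c => lt c w1) d Hd)) (HA u v Au Av Euv)). }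
      rewrite (Hev x x'), (Hev y y') by assumption; exact Heq.
    - exists b0; split; [exact Hb0|]; intros x y Ax Ay E _ c Hc.
      apply NNPP; intros Hne; apply M; exists x, y, c; auto. }
  destruct (choice _ HD) as [D HD'].
  destruct (omega1_cofinality Hwo Hw1 D (fun p => proj1 (HD' p))) as [d [Hd Hlt]].
  (* Agreement below [d] includes agreement at the separating index [D p], hence forces agreement at
     [d] itself. *)
  apply (HF d Hd); exists A; split; [exact UA|]; intros x y Ax Ay E.
  apply (proj2 (HD' (to_nat (G x, G y))) x y Ax Ay); [apply cancel_of_to| |exact Hd].
  exact (f_equal (fun J => J (exist (fun c => lt c d) _ (Hlt _))) E).
Qed.

Lemma finest_partition :
  exists f : K -> nat, forall (X : Type) (S : X -> Prop) (g : K -> X),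
    card_lt S (@fullset K) -> (forall x, S (g x)) ->
    exists (A : K -> Prop) (h : nat -> X), U A /\ (forall x, A x -> g x = h (f x)) /\
      forall n, S (h n).
Proof.
  destruct finest_countable_partition as [f Hf]; exists f; intros X S g HS Hg.
  destruct (small_range_countable g HS Hg) as [G [gG _]].
  destruct (determined_function (determined_trans gG (Hf G))) as [A [h [UA [HA Hh]]]].
  exists A, h; split; [exact UA|]; split; [exact HA|].
  intros n; destruct (Hh n) as [x ->]; apply Hg.
Qed.

(** * Levels of the tree and construction of the ascent path *)

Section Tree.

Variables (T : Type) (ltT : T -> T -> Prop).
Hypothesis ltT_trans : forall r s t, ltT r s -> ltT s t -> ltT r t.
Hypothesis level_nonempty : forall a, exists t, on_level lt ltT t a.
Hypothesis level_small : forall a, card_lt (level lt ltT a) (@fullset K).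

Lemma on_level_pred {t b} {g : T -> K} {s} :
  (forall s, ltT s t -> lt (g s) b) ->
  (forall c, lt c b -> exists s, ltT s t /\ g s = c) ->
  (forall s s', ltT s t -> ltT s' t -> (ltT s s' <-> lt (g s) (g s'))) ->
  ltT s t -> on_level lt ltT s (g s).
Proof.
  intros g1 g2 g3 Hs; exists g; split; [|split].
  - intros r Hr; apply g3; auto; exact (ltT_trans Hr Hs).
  - intros c Hc; destruct (g2 c) as [r [Hr E]]; [exact (trans Hc (g1 s Hs))|].
    exists r; split; [|exact E]; apply g3; auto; rewrite E; exact Hc.
  - intros r r' Hr Hr'; apply g3; [exact (ltT_trans Hr Hs)|exact (ltT_trans Hr' Hs)].
Qed.

(** Two isomorphisms from the predecessors of [t] onto ordinals agree, by induction on the value. *)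
Lemma on_level_unique {t a b} : on_level lt ltT t a -> on_level lt ltT t b -> a = b.
Proof.
  intros [g [g1 [g2 g3]]] [k [k1 [k2 k3]]].
  assert (E : forall c s, ltT s t -> g s = c -> k s = c).
  { intros c; induction (wf c) as [c _ IH]; intros s Hs Hc.
    apply (below_inj Hwo); intros d; split; intros Hd.
    - destruct (k2 d (trans Hd (k1 s Hs))) as [r [Hr Er]].
      rewrite <- Er in Hd |- *.
      assert (L : lt (g r) c) by (rewrite <- Hc; apply g3; auto; apply k3; auto).
      rewrite (IH (g r) L r Hr eq_refl); exact L.
    - assert (Hda : lt d a) by (apply (trans Hd); rewrite <- Hc; auto).
      destruct (g2 d Hda) as [r [Hr Er]].
      rewrite <- (IH d Hd r Hr Er); apply k3; auto; apply g3; auto; congruence. }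
  apply (below_inj Hwo); intros d; split; intros Hd.
  - destruct (g2 d Hd) as [s [Hs Es]]; rewrite <- (E d s Hs Es); auto.
  - destruct (k2 d Hd) as [s [Hs Es]].
    rewrite <- Es, (E _ s Hs eq_refl); auto.
Qed.

Lemma pred_on_level {t b a} : on_level lt ltT t b -> lt a b ->
  exists s, ltT s t /\ on_level lt ltT s a.
Proof.
  intros [g [g1 [g2 g3]]] Hab; destruct (g2 a Hab) as [s [Hs <-]].
  exists s; split; [exact Hs|exact (on_level_pred g1 g2 g3 Hs)].
Qed.

(* [on_level] allows [t] to have several predecessors on the same level, so predecessors of
   [t] are only compared across distinct levels. *)
Lemma preds_increasing {r s t a b} : on_level lt ltT r a -> on_level lt ltT s b ->
  ltT r t -> ltT s t -> (exists c, on_level lt ltT t c) -> lt a b -> ltT r s.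
Proof.
  intros Hr Hs rt st [c [g [g1 [g2 g3]]]] Hab; apply g3; auto.
  rewrite (on_level_unique (on_level_pred g1 g2 g3 rt) Hr).
  rewrite (on_level_unique (on_level_pred g1 g2 g3 st) Hs); exact Hab.
Qed.

(** In the ultrapower by the image of [U] under [f], the classes of the [h a] form a
    cofinal branch. *)
Lemma ultrapower_branch : exists (f : K -> nat) (h : K -> nat -> T),
  (forall a n, on_level lt ltT (h a n) a) /\
  (forall a b, lt a b -> U (fun x => ltT (h a (f x)) (h b (f x)))) /\
  (forall (X : Type) (g : K -> X), card_lt (@fullset X) (@fullset K) ->
    exists (A : K -> Prop) (q : nat -> X), U A /\ forall x, A x -> g x = q (f x)).
Proof.
  destruct finest_partition as [f Hf].
  destruct (choice _ level_nonempty) as [t Ht].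
  (* [tr a b] is the restriction of [t b] to level [a] when [a < b]; otherwise [t a] is a filler on
     the right level. *)
  destruct (choice (fun a (r : K -> T) => forall b, on_level lt ltT (r b) a /\
    (lt a b -> ltT (r b) (t b)))) as [tr Htr].
  { intros a; apply (choice (fun b s => on_level lt ltT s a /\ (lt a b -> ltT s (t b)))).
    intros b; destruct (classic (lt a b)) as [L|L].
    - destruct (pred_on_level (Ht b) L) as [s [H1 H2]]; exists s; auto.
    - exists (t a); split; [apply Ht|contradiction]. }
  destruct (choice (fun a (h : nat -> T) => (forall n, on_level lt ltT (h n) a) /\
    U (fun x => tr a x = h (f x)))) as [h Hh].
  { intros a; destruct (Hf _ _ (tr a) (level_small a) (fun b => proj1 (Htr a b)))
      as [A [h [UA [HA Hl]]]].
    exists h; split; [exact Hl|exact (ultrafilter_mono UA HA)]. }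
  exists f, h; split; [intros a; apply Hh|]; split.
  - intros a b Hab.
    (* For [x] above [b] in a set of [U], both nodes are predecessors of [t x], hence comparable. *)
    refine (ultrafilter_mono (ultrafilter_and (ultrafilter_tail b)
      (ultrafilter_and (proj2 (Hh a)) (proj2 (Hh b)))) _).
    intros x [Hx [<- <-]].
    apply (preds_increasing (t := t x) (proj1 (Htr a x)) (proj1 (Htr b x))); auto.
    + apply Htr, (trans Hab Hx).
    + apply Htr, Hx.
    + exists x; apply Ht.
  - intros X g HX; destruct (Hf _ _ g HX (fun _ => I)) as [A [q [UA [HA _]]]]; eauto.
Qed.

(** It suffices to have the [omega]-ascent path on an unbounded set of levels. *)
Lemma ascent_path_of_unbounded (S : K -> Prop) (p : K -> nat -> T) :
  (forall a, exists b, lt a b /\ S b) ->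
  (forall a i, on_level lt ltT (p a i) a) ->
  (forall a b, S a -> S b -> lt a b -> exists n, forall i, n <= i -> ltT (p a i) (p b i)) ->
  exists f, omega_ascent_path lt ltT f.
Proof.
  intros HS Hp Hasc.
  destruct (choice _ HS) as [s Hs].
  destruct (choice (fun a (r : nat -> T) =>
    forall i, ltT (r i) (p (s a) i) /\ on_level lt ltT (r i) a)) as [f Hf].
  { intros a; apply (choice (fun i r => ltT r (p (s a) i) /\ on_level lt ltT r a)).
    intros i; exact (pred_on_level (Hp (s a) i) (proj1 (Hs a))). }
  exists f; split; [intros a i; apply Hf|]; intros a b Hab.
  (* [c] is the larger of [s a] and [s b]; from some index on, both nodes lie below [p c i]. *)
  assert (M : exists c n, forall i, n <= i -> ltT (f a i) (p c i) /\ ltT (f b i) (p c i)).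
  { destruct (trich (s a) (s b)) as [L|[L|L]].
    - destruct (Hasc _ _ (proj2 (Hs a)) (proj2 (Hs b)) L) as [n Hn].
      exists (s b), n; intros i Hi; split; [|apply Hf].
      exact (ltT_trans (proj1 (Hf a i)) (Hn i Hi)).
    - exists (s b), 0; intros i _; split; [rewrite <- L|]; apply Hf.
    - destruct (Hasc _ _ (proj2 (Hs b)) (proj2 (Hs a)) L) as [n Hn].
      exists (s a), n; intros i Hi; split; [apply Hf|].
      exact (ltT_trans (proj1 (Hf b i)) (Hn i Hi)). }
  destruct M as [c [n Hn]]; exists n; intros i Hi; destruct (Hn i Hi) as [Ha Hb].
  apply (preds_increasing (proj2 (Hf a i)) (proj2 (Hf b i)) Ha Hb); [|exact Hab].
  exists c; apply Hp.
Qed.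

Lemma ascent_path_exists : exists p, omega_ascent_path lt ltT p.
Proof.
  destruct ultrapower_branch as [f [h [Hl [Hinc Hfine]]]].
  assert (small_rel : card_lt (@fullset (nat -> nat -> Prop)) (@fullset K))
    by exact (card_le_lt_trans (card_le_nat_relations Hwo Hw1) Hbig).
  assert (small_set : card_lt (@fullset (nat -> Prop)) (@fullset K)).
  { refine (card_le_lt_trans _ small_rel).
    exists (fun P _ => P); split; [exact (fun _ _ => I)|].
    intros P P' _ _ E; exact (f_equal (fun R => R 0) E). }
  destruct (choice (fun a (Q : nat -> nat -> Prop) =>
    U (fun b => (fun n => ltT (h a n) (h b n)) = Q (f b)))) as [Q HQ].
  { intros a; destruct (Hfine _ (fun b n => ltT (h a n) (h b n)) small_set)
      as [A [q [UA HA]]]; exists q; exact (ultrafilter_mono UA HA). }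
  destruct (small_fibre_unbounded Q small_rel) as [R HR].
  (* [E m] says that [R m] belongs to the image of [U] under [f]. *)
  set (E := fun m => U (fun x => R m (f x))).
  assert (HE : forall a b, lt a b -> (fun n => ltT (h a n) (h b n)) = R (f b) -> E (f b)).
  { intros a b Hab Heq; unfold E; rewrite <- Heq; exact (Hinc a b Hab). }
  (* Finitely many sets in the image ultrafilter have a common element; indices outside [E] impose
     no condition. *)
  assert (Hsel : forall k, exists n, forall m, m <= k -> E m -> R m n).
  { intros k; cut (U (fun x => forall m, m <= k -> E m -> R m (f x))).
    - intros Hk; destruct (ultrafilter_inhabited Hk) as [x Hx]; eauto.
    - assert (step : forall j, U (fun x => E j -> R j (f x))).
      { intros j; destruct (classic (E j)) as [Ej|Nj].
        - apply (ultrafilter_mono Ej); auto.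
        - apply (ultrafilter_mono (proj1 HU)); tauto. }
      induction k as [|k IH].
      + apply (ultrafilter_mono (step 0)); intros x Hx m Hm.
        replace m with 0 by lia; exact Hx.
      + apply (ultrafilter_mono (ultrafilter_and IH (step (S k)))).
        intros x [Hx Hk] m Hm.
        destruct (Nat.eq_dec m (S k)) as [->|]; [exact Hk|apply Hx; lia]. }
  destruct (choice _ Hsel) as [sel sel_spec].
  apply (@ascent_path_of_unbounded (fun a => Q a = R) (fun a i => h a (sel i)));
    [exact HR|auto|].
  intros a a' Ha Ha' Haa'.
  pose proof (HQ a) as Ua; pose proof (HQ a') as Ua'; rewrite Ha in Ua; rewrite Ha' in Ua'.
  destruct (ultrafilter_inhabited
    (ultrafilter_and (ultrafilter_tail a') (ultrafilter_and Ua Ua'))) as [b [Hb [Eb Eb']]].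
  (* From [i = f b] on, [sel i] lies in [R (f b)], the set on which both [h a] and [h a'] are below
     [h b]. *)
  exists (f b); intros i Hi.
  pose proof (sel_spec i (f b) Hi (HE a' b Hb Eb')) as Hr.
  assert (Hab : ltT (h a (sel i)) (h b (sel i)))
    by exact (eq_rect_r (fun P : nat -> Prop => P (sel i)) Hr Eb).
  assert (Hab' : ltT (h a' (sel i)) (h b (sel i)))
    by exact (eq_rect_r (fun P : nat -> Prop => P (sel i)) Hr Eb').
  apply (preds_increasing (Hl a (sel i)) (Hl a' (sel i)) Hab Hab'); eauto.
Qed.

End Tree.

End IndecomposableUltrafilter.

Theorem theorem4p10 (K : Type) (lt : K -> K -> Prop)
  (Hwo : strict_wellorder lt) (Hcard : is_cardinal_order lt)
  (Hreg : regular_order lt) (Hbig : gt_two_pow_aleph1 lt)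
  (U : (K -> Prop) -> Prop) (HU : ultrafilter U) (Huni : uniform U)
  (Hind : indecomposable lt U) :
  forall (T : Type) (ltT : T -> T -> Prop),
    kappa_aronszajn lt ltT -> exists f : K -> nat -> T, omega_ascent_path lt ltT f.
Proof.
  intros T ltT [[_ [Htr [_ Hne]]] [Hsm _]].
  destruct Hbig as [w1 [Hw1 Hb]].
  exact (ascent_path_exists Hwo Hcard Hreg HU Huni Hind Hw1 Hb Htr Hne Hsm).
Qed.
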